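(* Let $\ell\ge 3$ be an integer and let $s=\lceil \ell/2\rceil$. Fix a positive constant $c<\frac{1}{s(s-1)}$. For each $n$, let $G_{n,\ell}$ be a graph on $n$ vertices not containing $K_\ell$. If $\alpha(G_{n,\ell})<\mathbf{Q}(\ell,n)\,n^{c}$, then $e(G_{n,\ell})=o(n^2)$ as $n\to\infty$.
   Context: All graphs are simple. $K_\ell$ is the complete graph on $\ell$ vertices; $e(G)$ is the number of edges and $\alpha(G)$ the independence number of $G$. For integers $\ell\ge2$ and $n$, $\mathbf{Q}(\ell,n)$ denotes the minimum independence number over all $K_\ell$-free graphs on $n$ vertices. The assertion $e(G_{n,\ell})=o(n^2)$ means: for every $\varepsilon>0$ there is $n_0$ (depending on $\varepsilon,\ell,c$) such that for all $n\ge n_0$ every such graph $G_{n,\ell}$ has at most $\varepsilon n^2$ edges. *)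

(* Defs.v *)
From HB Require Import structures.
From mathcomp Require Import all_boot.

Set Implicit Arguments.
Unset Strict Implicit.
Unset Printing Implicit Defensive.

Record sgraph (V : finType) := SGraph {
  edges : {set {set V}};
  edges_card2 : [forall e in edges, #|e| == 2]
}.

HB.instance Definition _ (V : finType) := [isSub for @edges V].
HB.instance Definition _ (V : finType) := [Finite of sgraph V by <:].

(* Irreflexive, because [set x; x] is a singleton. *)
Definition adj (V : finType) (G : sgraph V) : rel V :=
  fun x y => [set x; y] \in edges G.

Definition clique (V : finType) (G : sgraph V) (S : {set V}) : bool :=
  [forall x in S, forall y in S, (x != y) ==> adj G x y].

Definition independent (V : finType) (G : sgraph V) (S : {set V}) : bool :=
  [forall x in S, forall y in S, ~~ adj G x y].

Definition K_free (l : nat) (V : finType) (G : sgraph V) : bool :=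
  ~~ [exists S : {set V}, (#|S| == l) && clique G S].

Definition alpha (V : finType) (G : sgraph V) : nat :=
  \max_(S : {set V} | independent G S) #|S|.

Lemma no_edges_card2 (V : finType) :
  [forall e in set0 : {set {set V}}, #|e| == 2].
Proof. by apply/forall_inP => e; rewrite inE. Qed.

Definition empty_graph (V : finType) : sgraph V := SGraph (no_edges_card2 V).

(* The empty graph only serves as a witness that the range of the minimum is
   nonempty, which holds for 2 <= l; see QP. *)
Definition Q (l n : nat) : nat :=
  alpha [arg min_(G < empty_graph 'I_n | K_free l G) alpha G].

Lemma empty_graph_K_free (l : nat) (V : finType) :
  2 <= l -> K_free l (empty_graph V).
Proof.
move=> l2; apply/existsPn => S; apply/negP => /andP[/eqP Sl /forall_inP cS].
have /card_gt1P[x [y [xS yS xy]]] : 1 < #|S| by rewrite Sl.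
by have /forall_inP/(_ y yS) := cS x xS; rewrite xy /adj inE.
Qed.

Lemma QP (l n : nat) : 2 <= l ->
  (exists2 G : sgraph 'I_n, K_free l G & alpha G = Q l n) /\
  (forall G : sgraph 'I_n, K_free l G -> Q l n <= alpha G).
Proof.
move=> l2; rewrite /Q; case: arg_minnP; first exact: empty_graph_K_free.
by move=> G KG minG; split; [exists G|].
Qed.

(* Main.v *)
(* If G has many edges, dependent random choice yields a linear-sized set U all
   of whose s-subsets have at least n^(1-delta) common neighbors. Any graph on
   more than alpha^(s-1) vertices without an independent set of size alpha + 1
   contains K_s, so U contains a K_s, and so does its common neighborhood; the
   two form a K_(2s), hence a K_l. This works as soon as alpha^(s-1) is
   polynomially smaller than n, which amounts to Q(l,n) <= n^(1/s+o(1)), since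
   1/s + c < 1/(s-1).

   As l >= 2s-1, the latter bound follows from Krivelevich's construction: in the
   binomial random graph with edge probability slightly below n^(-1/s), delete
   the edges of a maximal family of edge-disjoint (2s-1)-cliques. If a set T of
   size k, slightly above n^(1/s), became independent, then either many
   edge-disjoint cliques share an edge with T, or few cliques cover all edges
   inside T; both are excluded by a union bound. *)

Require Import Defs.
From mathcomp Require Import all_boot zify.

Set Implicit Arguments.
Unset Strict Implicit.
Unset Printing Implicit Defensive.

(** * Small Ramsey-type bounds *)

Lemma card_bigcup_le (I V : finType) (A : {set I}) (F : I -> {set V}) :
  #|\bigcup_(i in A) F i| <= \sum_(i in A) #|F i|.
Proof.
elim/big_rec2: _ => [|i m U _ IH]; first by rewrite cards0.
by apply: leq_trans (leq_card_setU _ _) _; rewrite leq_add2l.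
Qed.

Lemma leq_wexp2r e m n : m <= n -> m ^ e <= n ^ e.
Proof. by case: e => // e; rewrite leq_exp2r. Qed.

Lemma ffact_le_expn n k : n ^_ k <= n ^ k.
Proof.
elim: k => // k IHk; rewrite ffactnSr expnSr leq_mul //; exact: leq_subr.
Qed.

Lemma bin_le_expn n k : 'C(n, k) <= n ^ k.
Proof.
apply: leq_trans (ffact_le_expn n k).
by rewrite -bin_ffact leq_pmulr // fact_gt0.
Qed.

Section Graphs.
Variables (V : finType) (G : sgraph V).
Implicit Types (x y : V) (S T U : {set V}).

Definition nbr x : {set V} := [set y | adj G x y].
Definition common_nbr S : {set V} := [set y | [forall x in S, adj G x y]].

Lemma adjC x y : adj G x y = adj G y x.
Proof. by rewrite /adj setUC. Qed.

Lemma edge_card e : e \in edges G -> #|e| = 2.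
Proof. by move/(forall_inP (edges_card2 G)) => /eqP. Qed.

Lemma adjxx x : adj G x x = false.
Proof. by apply/negP => /edge_card; rewrite setUid cards1. Qed.

Lemma cliqueP S :
  reflect {in S &, forall x y, x != y -> adj G x y} (clique G S).
Proof.
apply: (iffP forall_inP) => [cS x y xS yS|cS x xS].
  by move: (cS x xS) => /forall_inP/(_ y yS)/implyP.
by apply/forall_inP => y yS; apply/implyP; apply: cS.
Qed.

Lemma independentP S :
  reflect {in S &, forall x y, ~~ adj G x y} (independent G S).
Proof.
apply: (iffP forall_inP) => [cS x y xS yS|cS x xS].
  by move: (cS x xS) => /forall_inP/(_ y yS).
by apply/forall_inP => y yS; apply: cS.
Qed.

Lemma clique_sub S T : S \subset T -> clique G T -> clique G S.
Proof.
move=> /subsetP ST /cliqueP cT; apply/cliqueP => x y xS yS.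
by apply: cT; apply: ST.
Qed.

Lemma independent_sub S T : S \subset T -> independent G T -> independent G S.
Proof.
move=> /subsetP ST /independentP cT; apply/independentP => x y xS yS.
by apply: cT; apply: ST.
Qed.

Lemma clique_setU S T : clique G S -> clique G T ->
  {in S & T, forall x y, adj G x y} -> clique G (S :|: T).
Proof.
move=> /cliqueP cS /cliqueP cT ST; apply/cliqueP => x y.
rewrite !inE => /orP[] xS /orP[] yS xy; [exact: cS|exact: ST| |exact: cT].
by rewrite adjC; apply: ST.
Qed.

Lemma clique1 x : clique G [set x].
Proof. by apply/cliqueP => y z /set1P-> /set1P->; rewrite eqxx. Qed.

Lemma card_subset S k : k <= #|S| -> exists2 T : {set V}, T \subset S & #|T| = k.
Proof.
rewrite -bin_gt0 -cards_draws => /card_gt0P[T].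
by rewrite inE => /andP[TS /eqP Tk]; exists T.
Qed.

Lemma K_freeP l : reflect (forall S, clique G S -> #|S| < l) (K_free l G).
Proof.
apply: (iffP existsPn) => [Gl S cS|Gl S].
  rewrite ltnNge; apply/negP => /card_subset[T TS Tl].
  by have := Gl T; rewrite Tl eqxx (clique_sub TS cS).
by apply/negP => /andP[/eqP Sl /Gl]; rewrite Sl ltnn.
Qed.

Lemma K_free_le l1 l2 : l1 <= l2 -> K_free l1 G -> K_free l2 G.
Proof.
by move=> l12 /K_freeP Gl; apply/K_freeP => S /Gl Sl; apply: leq_trans Sl l12.
Qed.

Lemma independent_le_alpha S : independent G S -> #|S| <= alpha G.
Proof. by move=> iS; apply: (@leq_bigmax_cond _ (independent G) (fun S => #|S|)). Qed.

(* A maximal independent set of U dominates U, so if it is small then one of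
   its vertices has a large neighborhood in U, on which we recurse. *)
Lemma clique_or_independent a r U : a ^ r <= #|U| ->
  (exists S, [/\ S \subset U, clique G S & #|S| = r.+1]) \/
  (exists S, [/\ S \subset U, independent G S & a <= #|S|]).
Proof.
elim: r U => [|r IHr] U aU.
  left; have /card_gt0P[x xU] : 0 < #|U| by [].
  by exists [set x]; rewrite sub1set cards1; split=> //; exact: clique1.
pose P S := (S \subset U) && independent G S.
have P0 : P set0.
  by rewrite /P sub0set; apply/independentP => x y; rewrite inE.
have [I /maxsetP[/andP[IU iI] maxI] _] := maxset_exists P0.
have [aI|Ia] := leqP a #|I|; first by right; exists I.
have cover : U \subset \bigcup_(x in I) (x |: (nbr x :&: U)).
  apply/subsetP => y yU; have [yI|yI] := boolP (y \in I).
    by apply/bigcupP; exists y; rewrite // !inE eqxx.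
  have : ~~ P (y |: I).
    apply/negP => PyI; move: yI.
    by rewrite -(maxI _ PyI (subsetUr _ _)) !inE eqxx.
  rewrite /P subUset sub1set yU IU /=.
  move=> H; have [|nex] := boolP [exists x in I, adj G x y].
    move=> /exists_inP[x xI xy]; apply/bigcupP; exists x => //.
    by rewrite !inE xy yU orbT.
  case/negP: H; apply/independentP => u v.
  rewrite !inE => /orP[/eqP->|uI] /orP[/eqP->|vI].
  - by rewrite adjxx.
  - by rewrite adjC; apply: contra nex => ?; apply/exists_inP; exists v.
  - by apply: contra nex => ?; apply/exists_inP; exists u.
  - exact: (independentP _ iI).
have [/existsP[v /andP[vI av]]|nobig] :=
  boolP [exists v, (v \in I) && (a ^ r <= #|nbr v :&: U|)].
  have [[S [SvU cS Sr]]|[S [SvU iS Sa]]] := IHr _ av; last first.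
    by right; exists S; split=> //; apply: subset_trans SvU (subsetIr _ _).
  have Sv x : x \in S -> adj G v x.
    by move=> /(subsetP SvU); rewrite !inE => /andP[].
  left; exists (v |: S); split.
  - by rewrite subUset sub1set (subsetP IU) // (subset_trans SvU) ?subsetIr.
  - apply: clique_setU (clique1 v) cS _ => x y /set1P-> yS; exact: Sv.
  - by rewrite cardsU1 Sr; case: (boolP (v \in S)) => // /Sv; rewrite adjxx.
suff : #|U| < a ^ r.+1 by rewrite ltnNge aU.
apply: (@leq_ltn_trans (#|I| * a ^ r)).
  apply: leq_trans (subset_leq_card cover) _.
  apply: leq_trans (card_bigcup_le _ _) _.
  rewrite -sum_nat_const; apply: leq_sum => x xI.
  have xN : x \notin nbr x :&: U by rewrite !inE adjxx.
  rewrite cardsU1 xN add1n ltnNge; apply: contra nobig => ax.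
  by apply/existsP; exists x; rewrite xI.
by rewrite expnS ltn_pmul2r // expn_gt0; move: Ia; case: (a).
Qed.

Lemma card_edges_le : #|edges G| <= \sum_x #|nbr x|.
Proof.
have -> : \sum_x #|nbr x| = #|[set p : V * V | adj G p.1 p.2]|.
  rewrite -sum1dep_card -(pair_big_dep predT (adj G) (fun _ _ => 1)) /=.
  by apply: eq_bigr => x _; rewrite sum1dep_card.
apply: leq_trans (leq_imset_card (fun p => [set p.1; p.2]) _).
apply/subset_leq_card/subsetP => e eG.
have /eqP/cards2P[x [y [_ def_e]]] := edge_card eG.
by apply/imsetP; exists (x, y); rewrite ?inE /adj /= -?def_e.
Qed.
End Graphs.

(** * Dependent random choice *)

Lemma card_ffun_in (I : finType) (V : finType) (A : {set V}) :
  #|[set f : {ffun I -> V} | [forall i, f i \in A]]| = #|A| ^ #|I|.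
Proof.
rewrite -(@card_ffun_on I V (mem A)); apply: eq_card => f; rewrite inE.
by apply/forallP/ffun_onP.
Qed.

Section DRC.
Variables (V : finType) (G : sgraph V).

Lemma degree_power_sum E h : 0 < #|V| ->
  2 * #|V| ^ 2 <= E * #|edges G| ->
  #|V| ^ h.+1 <= E ^ h.+1 * \sum_x #|nbr G x| ^ h.
Proof.
move=> V0 HE; set n := #|V| in V0 HE *.
pose W := [set x | n <= E * #|nbr G x|].
have nW : n <= E * #|W|.
  have : 2 * n ^ 2 <= E * #|W| * n + n ^ 2.
    apply: leq_trans HE _.
    apply: leq_trans (leq_mul (leqnn E) (card_edges_le G)) _.
    rewrite big_distrr /= (bigID (mem W)) /=; apply: leq_add.
      rewrite -mulnA mulnCA -sum_nat_const leq_sum // => x _.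
      by rewrite leq_mul2l max_card orbT.
    have -> : n ^ 2 = \sum_(x : V) n by rewrite sum_nat_const mulnn.
    rewrite [leqRHS](bigID (mem W)) /=; apply: leq_trans (leq_addl _ _).
    by apply: leq_sum => x; rewrite inE -ltnNge => /ltnW.
  by move: V0; nia.
rewrite expnSr (leq_trans (leq_mul (leqnn _) nW)) //.
rewrite expnSr -mulnA mulnCA [leqRHS]mulnCA leq_mul2l orbC.
rewrite big_distrr /= (bigID (mem W)) /= mulnC -sum_nat_const.
apply/orP; left; apply: leq_trans (leq_addr _ _).
by apply: leq_sum => x; rewrite inE -expnMn; apply: leq_wexp2r.
Qed.

(* For a uniformly random h-tuple X, the common neighborhood of X is large on
   average, whereas an s-set with few common neighbors is unlikely to lie in it;
   delete one vertex of each such s-set. *)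
Lemma dependent_random_choice E h s w : 0 < #|V| -> 0 < s ->
  2 * #|V| ^ 2 <= E * #|edges G| -> w ^ h * #|V| ^ s <= #|V| ^ h ->
  exists U : {set V}, #|V| <= E ^ h.+1 * (#|U|.+1) /\
    forall S : {set V}, S \subset U -> #|S| = s -> w <= #|common_nbr G S|.
Proof.
move=> V0 s0 HE Hw; pose n := #|V|; pose F := E ^ h.+1.
pose N (X : {ffun 'I_h -> V}) : {set V} := [set v | [forall i, X i \in nbr G v]].
pose bad := [set S : {set V} | (#|S| == s) && (#|common_nbr G S| < w)].
pose B X := [set S in bad | S \subset N X].
have sumN : n ^ h.+1 <= F * \sum_X #|N X|.
  have -> : \sum_X #|N X| = \sum_x #|nbr G x| ^ h.
    under eq_bigr do rewrite -sum1dep_card.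
    rewrite (exchange_big_dep predT) //=; apply: eq_bigr => x _.
    by rewrite sum1dep_card card_ffun_in card_ord.
  exact: degree_power_sum.
have sumB : \sum_X #|B X| <= n ^ h.
  under eq_bigr do rewrite -sum1dep_card.
  rewrite (exchange_big_dep (mem bad)) /=; last by move=> X S _ /andP[].
  apply: leq_trans Hw.
  apply: (@leq_trans (\sum_(S in bad) w ^ h)); last first.
    rewrite sum_nat_const mulnC leq_mul2l; apply/orP; right.
    apply: leq_trans (bin_le_expn _ _); rewrite -card_draws subset_leq_card //.
    by apply/subsetP => S; rewrite !inE => /andP[].
  apply: leq_sum => S Sbad; rewrite Sbad /= sum1dep_card.
  apply: (@leq_trans (#|common_nbr G S| ^ h)); last first.
    by move: Sbad;  rewrite inE => /andP[_ /ltnW]; apply: leq_wexp2r.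
  rewrite -[X in _ <= _ ^ X]card_ord -card_ffun_in subset_leq_card //.
  apply/subsetP => X; rewrite !inE => /subsetP SN; apply/forallP => i.
  rewrite inE; apply/forall_inP => x /SN.
  by rewrite inE => /forallP/(_ i); rewrite inE.
have [X HX] : exists X, n + F * #|B X| <= F * (#|N X|).+1.
  apply/existsP; apply: contraT => /existsPn nX.
  have : \sum_X (F * #|N X|.+1).+1 <= \sum_X (n + F * #|B X|).
    by apply: leq_sum => X _; rewrite ltnNge.
  have cX : #|{: {ffun 'I_h -> V}}| = n ^ h by rewrite card_ffun card_ord.
  have nh0 : 0 < n ^ h by rewrite expn_gt0 V0.
  under eq_bigr do rewrite -addn1 mulnS.
  rewrite !big_split /= !sum_nat_const !cX -!big_distrr /=.
  move: sumN; rewrite (expnSr n) => HN.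
  have HB : F * (\sum_X #|B X|) <= n ^ h * F by rewrite mulnC leq_mul2r sumB orbT.
  rewrite muln1 => /leq_trans/(_ (leq_add HN HB)).
  move: (n ^ h * F) (F * \sum_X #|N X|) (n ^ h) nh0 => x y z; lia.
have pick_in S : S \in B X -> exists x, x \in S.
  by rewrite !inE => /andP[/andP[/eqP cS _] _]; apply/card_gt0P; rewrite cS.
have /card_gt0P[x0 _] := V0.
pose p (S : {set V}) := odflt x0 [pick x in S].
exists (N X :\: p @: B X); split.
  rewrite -(leq_add2r (F * #|B X|)) -mulnDr (leq_trans HX) // leq_mul2l.
  rewrite -(cardsID (p @: B X) (N X)) addSn ltnS addnC leq_add2l.
  apply/orP; right; apply: leq_trans (leq_imset_card p (B X)).
  exact/subset_leq_card/subsetIr.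
move=> S SU cS; rewrite leqNgt; apply/negP => Sw.
have SB : S \in B X.
  by rewrite !inE cS Sw eqxx (subset_trans SU) // subsetDl.
have pS : p S \in S.
  by rewrite /p; case: pickP => //= S0; have [x] := pick_in S SB; rewrite S0.
by have := subsetP SU _ pS; rewrite inE imset_f.
Qed.
End DRC.

(** * Clique packings *)

Lemma card_ffun_prescribed (I K : finType) (C : {set K}) (P : {set I}) :
  #|[set f : {ffun I -> K} | [forall i in P, f i \in C]]| * #|K| ^ #|P| =
  #|C| ^ #|P| * #|{: {ffun I -> K}}|.
Proof.
have -> : #|[set f : {ffun I -> K} | [forall i in P, f i \in C]]| =
    #|C| ^ #|P| * #|K| ^ #|~: P|.
  pose F i : pred K := [pred y | (i \in P) ==> (y \in C)].
  transitivity #|(family F : simpl_pred {ffun I -> K})|.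
    apply: eq_card => f; rewrite inE.
    by apply/forall_inP/familyP => fP i; [rewrite inE; apply/implyP/fP|exact/implyP/fP].
  rewrite card_family foldrE big_map big_enum /= (bigID (mem P)) /=.
  rewrite -!prod_nat_const; congr (_ * _).
    by apply: eq_bigr => i iP; apply: eq_card => y; rewrite inE iP.
  apply: eq_big => [i|i iP]; first by rewrite inE.
  by apply: eq_card => y; rewrite inE (negbTE iP).
by rewrite card_ffun -mulnA -expnD [_ + #|P|]addnC cardsC.
Qed.

Lemma bin_le_exp2 n k : 'C(n, k) <= 2 ^ n.
Proof.
rewrite -[n in 'C(n, _)]card_ord -card_draws -[n in 2 ^ n]card_ord -cardsT.
by rewrite -card_powerset subset_leq_card //; apply/subsetP => A _; rewrite inE subsetT.
Qed.

Lemma expn_le_fact n : n ^ n <= 4 ^ n * n`!.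
Proof.
have H j : n ^ j <= (n + j) ^_ j.
  elim: j => // j IHj; rewrite addnS ffactnS expnS leq_mul //=.
  by rewrite ltnW // ltnS leq_addr.
apply: leq_trans (H n) _; rewrite -bin_ffact leq_mul2r.
by rewrite -[4]/(2 ^ 2) -expnM mul2n -addnn bin_le_exp2 orbT.
Qed.

Section Packing.
Variables (V : finType).
Implicit Types (S T : {set V}) (F M : {set {set V}}).

Definition pairs S : {set {set V}} := [set e : {set V} | (e \subset S) && (#|e| == 2)].
Definition covered F : {set {set V}} := \bigcup_(S in F) pairs S.
Definition packing l F :=
  [forall S in F, (#|S| == l) && [forall T in F, (S != T) ==> (#|S :&: T| <= 1)]].

Lemma card_pairs S : #|pairs S| = 'C(#|S|, 2).
Proof. exact: cards_draws. Qed.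

Lemma packingP l F :
  reflect [/\ {in F, forall S, #|S| = l} &
              {in F &, forall S T, S != T -> #|S :&: T| <= 1}] (packing l F).
Proof.
apply: (iffP forall_inP) => [PF|[Fl FF] S SF].
  split=> [S SF|S T SF TF ST]; case/andP: (PF S SF) => /eqP // _ /forall_inP.
  by move=> /(_ T TF)/implyP; apply.
by rewrite Fl ?eqxx //; apply/forall_inP => T TF; apply/implyP; apply: FF.
Qed.

Lemma packing_sub l F M : F \subset M -> packing l M -> packing l F.
Proof.
move=> /subsetP FM /packingP[Ml MM]; apply/packingP.
by split=> [S /FM|S T /FM SM /FM TM]; [exact: Ml|exact: MM].
Qed.

Lemma card_covered l F : packing l F -> #|F| * 'C(l, 2) <= #|covered F|.
Proof.
move=> /packingP[Fl FF].
pose P S := if S \in F then pairs S else set0.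
have PP S T : S != T -> [disjoint P S & P T].
  rewrite /P; case: ifP => SF; last by rewrite -setI_eq0 set0I.
  case: ifP => TF ST; last by rewrite -setI_eq0 setI0.
  rewrite -setI_eq0; apply/eqP/setP => e; rewrite !inE; apply/negP.
  move=> /andP[/andP[eS /eqP e2] /andP[eT _]].
  have : #|e| <= #|S :&: T| by rewrite subset_leq_card // subsetI eS.
  by rewrite e2 ltnNge FF.
have -> : covered F = \bigcup_S P S.
  by rewrite /covered big_mkcond; apply: eq_bigr.
rewrite -[leqRHS]sum1_card (partition_disjoint_bigcup _ _ PP) /=.
rewrite -sum_nat_const big_mkcond leq_sum // => S _.
by case: ifP => // SF; rewrite sum1_card /P SF card_pairs Fl.
Qed.

(* H is obtained by deleting all edges of a maximal edge-disjoint family M of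
   l-cliques of G. *)
Lemma clique_packing_deletion l (G : sgraph V) : 2 <= l ->
  exists (H : sgraph V) (M : {set {set V}}),
    [/\ K_free l H, packing l M, {in M, forall S, clique G S} &
        forall T, independent H T ->
        {in pairs T, forall e, e \in edges G -> e \in covered M}].
Proof.
move=> l2; pose P M := packing l M && [forall S in M, clique G S].
have P0 : P set0.
  by rewrite /P; apply/andP; split; apply/forall_inP => S; rewrite inE.
have [M /maxsetP[/andP[pM /forall_inP cM] maxM] _] := maxset_exists P0.
have H2 : [forall e in edges G :\: covered M, #|e| == 2].
  by apply/forall_inP => e /setDP[/edge_card/eqP].
exists (SGraph H2), M; split=> //; last first.
  move=> T /independentP iT e; rewrite inE => /andP[eT /cards2P[x [y [_ def_e]]]].
  move=> eG; apply: contraT => ecov.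
  have /iT : x \in T by apply: (subsetP eT); rewrite def_e !inE eqxx.
  move=> /(_ y); rewrite /adj -def_e inE ecov eG; apply.
  by apply: (subsetP eT); rewrite def_e !inE eqxx orbT.
have HG S : clique (SGraph H2) S -> clique G S.
  move=> /cliqueP cS; apply/cliqueP => x y xS yS xy.
  by have := cS x y xS yS xy; rewrite /adj inE => /andP[].
apply/existsPn => S; apply/negP => /andP[/eqP Sl cS].
have uncovered e : e \in pairs S -> e \notin covered M.
  rewrite inE => /andP[eS /cards2P[x [y [xy def_e]]]].
  have := cliqueP _ _ cS x y; rewrite /adj -def_e inE.
  by case: (e \in covered M) => //; apply=> //; apply: (subsetP eS);
    rewrite def_e !inE eqxx ?orbT.
have SM T : T \in M -> #|S :&: T| <= 1.
  move=> TM; rewrite leqNgt; apply/negP => /card_subset[e].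
  rewrite subsetI => /andP[eS eT] e2.
  have /negP[] : e \notin covered M by apply: uncovered; rewrite inE eS e2.
  by apply/bigcupP; exists T => //; rewrite inE eT e2.
have SnM : S \notin M.
  by apply/negP => /SM; rewrite setIid Sl leqNgt l2.
move/packingP: pM => [Ml MM].
have PSM : P (S |: M).
  apply/andP; split; last first.
    by apply/forall_inP => T; rewrite !inE => /orP[/eqP->|/cM//]; apply: HG.
  apply/packingP; split=> [T|T T']; rewrite !inE.
    by move=> /orP[/eqP->|/Ml].
  move=> /orP[/eqP->|TM] /orP[/eqP->|TM']; rewrite ?eqxx //.
  - by move=> _; apply: SM.
  - by move=> _; rewrite setIC; apply: SM.
  - exact: MM.
by move: SnM; rewrite -(maxM _ PSM (subsetUr _ _)) !inE eqxx.
Qed.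

Lemma card_sets_meeting T l : 2 <= l ->
  #|[set S : {set V} | (#|S| == l) && (2 <= #|S :&: T|)]| <=
  #|T| ^ 2 * #|V| ^ (l - 2).
Proof.
move=> l2; pose D := setX (pairs T) [set B : {set V} | #|B| == l - 2].
apply: (@leq_trans #|D|); last first.
  by rewrite cardsX card_pairs card_draws leq_mul // bin_le_expn.
apply: leq_trans (leq_imset_card (fun p => p.1 :|: p.2) _).
apply/subset_leq_card/subsetP => S; rewrite inE => /andP[/eqP Sl].
move=> /card_subset[A]; rewrite subsetI => /andP[AS AT] A2.
apply/imsetP; exists (A, S :\: A); last by rewrite /= -[LHS](setID S A) (setIidPr AS).
by rewrite !inE /= AT A2 /= cardsD (setIidPr AS) Sl A2.
Qed.
End Packing.

(** * The random graph with a clique packing deleted *)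

Lemma leq_mul_bigcup (I V : finType) (A : {set I}) (F : I -> {set V}) a b :
  (forall i, i \in A -> #|F i| * a <= b) ->
  #|\bigcup_(i in A) F i| * a <= #|A| * b.
Proof.
move=> Fab; apply: leq_trans (leq_mul (card_bigcup_le _ _) (leqnn a)) _.
by rewrite big_distrl -sum_nat_const leq_sum.
Qed.

Section RandomGraph.
Variables (V : finType) (l k t m : nat).
Hypothesis l2 : 2 <= l.

(* A uniformly random colouring f stands for the binomial random graph with edge
   probability 1 / m.+1, the edges being the pairs of colour 0. *)
Local Notation coloring := {ffun {set V} -> 'I_m.+1}.

Lemma random_graph_subproof (f : coloring) :
  [forall e in [set e : {set V} | (#|e| == 2) && (f e == ord0)], #|e| == 2].
Proof. by apply/forall_inP => e; rewrite inE => /andP[]. Qed.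

Definition random_graph f : sgraph V := SGraph (random_graph_subproof f).

Definition all_present (P : {set {set V}}) : {set coloring} :=
  [set f : coloring | [forall e in P, f e \in [set ord0]]].
Definition all_absent (P : {set {set V}}) : {set coloring} :=
  [set f : coloring | [forall e in P, f e \in [set~ ord0]]].

Definition ksets : {set {set V}} := [set T : {set V} | #|T| == k].
Definition packings_at (T : {set V}) : {set {set {set V}}} :=
  [set F : {set {set V}} | [&& #|F| == t, packing l F &
    F \subset [set S : {set V} | (#|S| == l) && (2 <= #|S :&: T|)]]].
Definition many_cliques : {set coloring} :=
  \bigcup_(T in ksets) \bigcup_(F in packings_at T) all_present (covered F).

Definition listed (g : {ffun 'I_t * 'I_l -> V}) : {set {set V}} :=
  \bigcup_i pairs [set g (i, j) | j : 'I_l].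
Definition few_edges : {set coloring} :=
  \bigcup_(T in ksets) \bigcup_(g in [set: {ffun 'I_t * 'I_l -> V}])
    all_absent (pairs T :\: listed g).

Local Notation N := #|{: coloring}|.

Lemma card_ksets : #|ksets| <= #|V| ^ k.
Proof. by rewrite card_draws bin_le_expn. Qed.

Lemma card_packings_at (T : {set V}) : #|T| = k ->
  #|packings_at T| * t ^ t <= (4 * (k ^ 2 * #|V| ^ (l - 2))) ^ t.
Proof.
move=> Tk; set X := [set S : {set V} | (#|S| == l) && (2 <= #|S :&: T|)].
have cX : #|X| <= k ^ 2 * #|V| ^ (l - 2) by rewrite -Tk card_sets_meeting.
apply: leq_trans (leq_mul (leqnn _) (expn_le_fact t)) _.
rewrite mulnCA expnMn leq_mul2l; apply/orP; right.
apply: leq_trans (leq_wexp2r t cX); apply: leq_trans (ffact_le_expn _ _).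
rewrite -bin_ffact leq_mul2r -cards_draws subset_leq_card ?orbT //.
by apply/subsetP => F; rewrite !inE => /and3P[-> _ ->].
Qed.

Lemma card_many_cliques :
  #|many_cliques| * (m.+1 ^ (t * 'C(l, 2)) * t ^ t) <=
  #|V| ^ k * ((4 * (k ^ 2 * #|V| ^ (l - 2))) ^ t * N).
Proof.
apply: leq_trans (leq_mul card_ksets (leqnn _)).
apply: leq_mul_bigcup => T; rewrite inE => /eqP Tk.
apply: (@leq_trans (#|packings_at T| * N * t ^ t)); last first.
  by rewrite mulnAC leq_mul2r card_packings_at // orbT.
rewrite mulnA leq_mul2r; apply/orP; right.
apply: leq_mul_bigcup => F; rewrite inE => /and3P[/eqP Ft pF _].
have := card_ffun_prescribed [set (ord0 : 'I_m.+1)] (covered F).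
rewrite cards1 exp1n mul1n card_ord -/(all_present _) => <-.
by rewrite leq_mul2l leq_pexp2l ?orbT // -Ft card_covered.
Qed.

Lemma card_listed g : #|listed g| <= t * l ^ 2.
Proof.
rewrite -[t in leqRHS]card_ord -sum_nat_const /listed.
elim/big_rec2: _ => [|i a U _ IH]; first by rewrite cards0.
apply: leq_trans (leq_card_setU _ _) _; apply: leq_add IH.
rewrite card_pairs; apply: leq_trans (bin_le_expn _ _) _.
apply: leq_wexp2r; apply: leq_trans (leq_imset_card _ _) _.
by rewrite card_ord.
Qed.

Lemma card_few_edges :
  #|few_edges| * m.+1 ^ ('C(k, 2) - t * l ^ 2) <=
  #|V| ^ (k + t * l) * (m ^ ('C(k, 2) - t * l ^ 2) * N).
Proof.
set a := _ - _; rewrite expnD -mulnA.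
apply: leq_trans (leq_mul card_ksets (leqnn _)).
apply: leq_mul_bigcup => T; rewrite inE => /eqP Tk.
have -> : #|V| ^ (t * l) = #|[set: {ffun 'I_t * 'I_l -> V}]|.
  by rewrite cardsT card_ffun card_prod !card_ord.
apply: leq_mul_bigcup => g _; set P := pairs T :\: listed g.
have aP : a <= #|P|.
  rewrite /a -Tk -card_pairs leq_subLR -(cardsID (listed g)) leq_add2r.
  by apply: leq_trans (card_listed g); rewrite subset_leq_card // subsetIr.
have := card_ffun_prescribed [set~ (ord0 : 'I_m.+1)] P.
rewrite cardsC1 card_ord /= -/(all_absent _) -(subnKC aP) !expnD => eqP_.
rewrite -(leq_pmul2r (_ : 0 < m.+1 ^ (#|P| - a))) ?expn_gt0 // -mulnA eqP_.
by rewrite mulnAC leq_mul2l leq_wexp2r ?orbT.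
Qed.

Lemma exists_graph_of_coloring (f : coloring) : 0 < k ->
  f \notin many_cliques -> f \notin few_edges ->
  exists2 H : sgraph V, K_free l H & alpha H < k.
Proof.
move=> k0 fM fE.
have [H [M [HK pM cM iH]]] := clique_packing_deletion (random_graph f) l2.
exists H => //; rewrite -(prednK k0) ltnS; apply/bigmax_leqP => T' iT'.
rewrite -ltnS (prednK k0) ltnNge; apply/negP => /card_subset[T TT' Tk].
have {iT' TT'} iT := independent_sub TT' iT'.
have Tks : T \in ksets by rewrite inE Tk.
have presentM (F : {set {set V}}) : F \subset M -> f \in all_present (covered F).
  move=> /subsetP FM; rewrite inE; apply/forall_inP => e /bigcupP[S /FM SM].
  rewrite inE => /andP[eS e2]; rewrite inE.
  have /cards2P[x [y [xy def_e]]] := e2.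
  have := cliqueP _ _ (cM S SM) x y; rewrite /adj -def_e inE e2 /=.
  by apply=> //; apply: (subsetP eS); rewrite def_e !inE eqxx ?orbT.
pose MT := [set S in M | 2 <= #|S :&: T|].
have MTM : MT \subset M by apply/subsetP => S; rewrite inE => /andP[].
have [|MTt] := leqP t #|MT|.
  move=> /card_subset[F FMT Ft]; have FM := subset_trans FMT MTM.
  case/negP: fM; apply/bigcupP; exists T => //; apply/bigcupP.
  exists F; last exact: presentM.
  rewrite inE Ft eqxx (packing_sub FM pM) /=.
  apply/subsetP => S /(subsetP FMT); rewrite !inE => /andP[SM ->].
  by have /packingP[-> //] := pM; rewrite eqxx.
case/negP: fE; apply/bigcupP; exists T => //.
have [x0 _] : exists x0 : V, x0 \in T by apply/card_gt0P; rewrite Tk.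
pose g := [ffun p : 'I_t * 'I_l => nth x0 (enum (nth set0 (enum MT) p.1)) p.2].
apply/bigcupP; exists g; rewrite ?inE //; apply/forall_inP => e.
rewrite !inE => /andP[eg eT]; apply: contra eg => /eqP fe.
have e2 : #|e| == 2 by case/andP: eT.
have eG : e \in edges (random_graph f) by rewrite inE e2 fe eqxx.
have ePT : e \in pairs T by rewrite inE.
have /bigcupP[S SM] := iH T iT e ePT eG; rewrite inE => /andP[eS _].
have SMT : S \in MT.
  rewrite inE SM -(eqP e2) subset_leq_card // subsetI eS.
  by case/andP: eT.
have it : index S (enum MT) < t.
  by apply: leq_trans MTt; rewrite ltnS cardE ltnW // index_mem mem_enum.
apply/bigcupP; exists (Ordinal it) => //; rewrite inE e2 andbT.
apply/subsetP => x /(subsetP eS) xS.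
have jl : index x (enum S) < l.
  have /packingP[Ml _] := pM.
  by rewrite -(Ml S SM) cardE index_mem mem_enum.
by apply/imsetP; exists (Ordinal jl); rewrite // ffunE /= !nth_index ?mem_enum.
Qed.

Lemma exists_K_free_small_alpha : 0 < k ->
  2 * #|V| ^ k * (4 * (k ^ 2 * #|V| ^ (l - 2))) ^ t < m.+1 ^ (t * 'C(l, 2)) * t ^ t ->
  2 * #|V| ^ (k + t * l) * m ^ ('C(k, 2) - t * l ^ 2) < m.+1 ^ ('C(k, 2) - t * l ^ 2) ->
  exists2 H : sgraph V, K_free l H & alpha H < k.
Proof.
move=> k0 H1 H2.
have N0 : 0 < N by rewrite card_ffun card_ord expn_gt0.
have half (B : {set coloring}) x y :
    #|B| * x <= y * N -> 2 * y < x -> 2 * #|B| < N.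
  move=> Bxy yx; rewrite -(ltn_pmul2r (leq_ltn_trans (leq0n _) yx)).
  by rewrite -mulnA (leq_ltn_trans (leq_mul (leqnn 2) Bxy)) // mulnA mulnC ltn_pmul2l.
have B1 : 2 * #|many_cliques| < N.
  by have := card_many_cliques; rewrite [leqRHS]mulnA => /half; apply; rewrite mulnA.
have B2 : 2 * #|few_edges| < N.
  by have := card_few_edges; rewrite [leqRHS]mulnA => /half; apply; rewrite mulnA.
have /card_gt0P[f] : 0 < #|~: (many_cliques :|: few_edges)|.
  rewrite -(ltn_add2l #|many_cliques :|: few_edges|) addn0 cardsC.
  apply: leq_ltn_trans (leq_card_setU _ _) _.
  by rewrite -(@ltn_pmul2l 2) // mulnDr [ltnRHS]mul2n -addnn -addSn leq_add // ltnW.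
rewrite !inE negb_or => /andP[fM fE].
exact: exists_graph_of_coloring fM fE.
Qed.
End RandomGraph.

(** * Choice of parameters and the bound on Q *)

Lemma linear_le_exp2 c u : 2 * c <= u -> c * u.+1 <= 2 ^ u.
Proof.
have base : c * (2 * c).+1 <= 2 ^ (2 * c).
  rewrite expnM; elim: c => // -[|c] IHc //.
  by rewrite expnS; move: IHc; nia.
move=> /subnKC <-; elim: (u - 2 * c) => [|j IHj]; first by rewrite addn0.
by rewrite addnS expnS; nia.
Qed.

Lemma exp2_pred_le m : 2 * m ^ m.+1 <= m.+1 ^ m.+1.
Proof.
have H j : m ^ j * (m + j) <= m.+1 ^ j * m.
  by elim: j => [|j IHj]; rewrite ?addn0 // !expnS; nia.
rewrite expnS mulnA mulnC mul2n -addnn (leq_trans (H m)) // expnS mulnC.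
by rewrite leq_mul2r leqnSn orbT.
Qed.

Lemma exp_pred_gap m a b : m.+1 * b <= a -> 2 ^ b * m ^ a <= m.+1 ^ a.
Proof.
move=> /subnKC <-; rewrite (expnD m) (expnD m.+1) mulnA !(expnM _ m.+1) -expnMn.
by apply: leq_mul; apply: leq_wexp2r; [exact: exp2_pred_le|exact: leqnSn].
Qed.

(* The random graph on at most q^((r+2)d) vertices with edge probability
   q^-(d+1), where q = 2^u. *)
Lemma K_free_small_alpha r d u n : 0 < d -> 0 < u ->
  (let b := (r + 2) * d in let l := 2 * r + 3 in
    4 * (2 * b * l ^ 2 + u * b * (1 + 2 * b * l) + 2) <= 2 ^ u) ->
  n <= 2 ^ (u * ((r + 2) * d)) ->
  exists2 H : sgraph 'I_n, K_free (2 * r + 3) H & alpha H < 2 ^ (u * (d + 2)).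
Proof.
move=> d0 u0 /=; set b := (r + 2) * d; set l := 2 * r + 3.
have [q qE] : exists q, q = 2 ^ u by exists (2 ^ u).
rewrite !(expnM 2 u) -qE => Hq nN.
have q2 : 2 <= q by rewrite qE -[2]expn1 leq_exp2l.
have q0 : 0 < q by lia.
have b2 : 2 <= b by rewrite /b; nia.
set k := q ^ (d + 2); set M := q ^ (d + 1); pose t := 2 * b * k.
have k2 : 2 <= k by rewrite /k addn2 expnS (leq_trans q2) // leq_pmulr // expn_gt0 q0.
have M2 : 2 <= M by rewrite /M addn1 expnS (leq_trans q2) // leq_pmulr // expn_gt0 q0.
have kM : k = M * q by rewrite /k /M addn2 addn1 expnSr.
have MS : M = M.-1.+1 by rewrite prednK //; lia.
set N := q ^ b in nN.
have N2 : 2 <= N by rewrite -[2]expn1 (leq_trans (leq_wexp2r 1 q2)) // leq_exp2l //; lia.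
have l2 : 2 <= l by rewrite /l; lia.
apply: (@exists_K_free_small_alpha _ l k t M.-1); rewrite ?card_ord -?MS //; first lia.
  have tt : (4 * k) ^ t <= t ^ t by rewrite leq_wexp2r // /t; nia.
  apply: leq_trans (leq_mul (leqnn _) tt).
  have qM : q * (k * N ^ (l - 2)) <= M ^ 'C(l, 2).
    rewrite /k /M /N -!expnM -expnD -expnS leq_exp2l //.
    rewrite /l /b bin2.
    have -> : ((2 * r + 3) * (2 * r + 3).-1)./2 = (2 * r + 3) * (r + 1).
      by rewrite -[RHS]doubleK; congr (_./2); rewrite -muln2; lia.
    by have -> : 2 * r + 3 - 2 = 2 * r + 1 by [lia]; nia.
  have nk : n ^ k <= N ^ k by exact: leq_wexp2r.
  have nl : (k * n ^ (l - 2)) ^ t <= (k * N ^ (l - 2)) ^ t.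
    exact: leq_wexp2r (leq_mul (leqnn k) (leq_wexp2r _ nN)).
  have Hk : 2 * N ^ k < q ^ t.
    have -> : q ^ t = N ^ k * N ^ k.
      by rewrite /N /t -!expnM -expnD; congr (_ ^ _); lia.
    rewrite ltn_pmul2r; last by rewrite expn_gt0 (ltnW N2).
    have h1 : 2 < 2 ^ k by apply: leq_ltn_trans k2 _; apply: ltn_expl.
    exact: leq_trans h1 (leq_wexp2r k N2).
  have -> : 4 * (k ^ 2 * n ^ (l - 2)) = k * n ^ (l - 2) * (4 * k) by rewrite -mulnn; lia.
  rewrite (expnMn _ (4 * k)) mulnA ltn_pmul2r; last by rewrite expn_gt0; lia.
  rewrite mulnC [t * _]mulnC expnM.
  apply: leq_trans (leq_wexp2r t qM); rewrite (expnMn q).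
  apply: (@leq_ltn_trans ((k * N ^ (l - 2)) ^ t * (2 * N ^ k))).
    by apply: leq_mul nl _; rewrite leq_mul2l nk orbT.
  by rewrite mulnC ltn_pmul2r // expn_gt0 muln_gt0 expn_gt0; lia.
set B := u * b * (k + t * l) + 2.
have AB : M.-1.+1 * B <= 'C(k, 2) - t * l ^ 2.
  have kk : k * k <= 4 * 'C(k, 2).
    have : 2 * 'C(k, 2) = k * k.-1.
      rewrite bin2 mul2n -[RHS]odd_double_half oddM.
      by case: (k) k2 => // -[|j] _; rewrite /= ?negbK; case: odd.
    move: k2; case: (k) => //= k'; nia.
  have H1 : 4 * (t * l ^ 2 + M * B) <= k * k.
    apply: (@leq_trans (M * k * q)); last by rewrite {3}kM; lia.
    apply: leq_trans (leq_mul (leqnn _) Hq).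
    rewrite mulnCA leq_mul2l; apply/orP; right.
    rewrite /B /t; nia.
  by rewrite -MS; lia.
rewrite [X in _ < X ^ _]MS.
apply: leq_trans (exp_pred_gap AB); rewrite ltn_pmul2r; last first.
  by rewrite expn_gt0; lia.
rewrite /B addn2 expnS ltn_pmul2l //.
apply: (@leq_ltn_trans (2 ^ (u * b * (k + t * l)))); last by rewrite ltn_exp2l.
by rewrite expnM leq_wexp2r // expnM -qE.
Qed.

Lemma Q_upper_bound r d : 0 < d ->
  exists n0, forall n l, n0 <= n -> 2 * r + 3 <= l ->
  Q l n ^ ((r + 2) * d) <= (2 ^ ((r + 2) * d) * n) ^ (d + 2).
Proof.
move=> d0; set b := (r + 2) * d; pose l0 := 2 * r + 3.
have b0 : 0 < b by rewrite /b muln_gt0 d0 addn2.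
pose c := 4 * (2 * b * l0 ^ 2 + b * (1 + 2 * b * l0) + 2).
exists (2 ^ (2 * c * b)).+1 => n l n0n ll0.
have [u nu minu] : exists2 u, n <= 2 ^ (u * b) & forall v, n <= 2 ^ (v * b) -> u <= v.
  have exu : exists u, n <= 2 ^ (u * b).
    exists n; rewrite (leq_trans (ltnW (ltn_expl n (isT : 1 < 2)))) //.
    by rewrite leq_exp2l // leq_pmulr.
  by case: (ex_minnP exu) => u nu minu; exists u.
have cu : 2 * c < u.
  by rewrite -(ltn_pmul2r b0) -(@ltn_exp2l 2) // (leq_trans n0n).
have [|H HK Ha] := @K_free_small_alpha r d u n d0 (leq_ltn_trans (leq0n _) cu) _ nu.
  apply: leq_trans (linear_le_exp2 (ltnW cu)).
  rewrite -/b -/l0 /c -(mulnA u) -(mulnA 4) leq_mul2l.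
  move: (2 * b * _ ^ 2) (b * _) => x y; nia.
have Qa : Q l n <= 2 ^ (u * (d + 2)).
  have [_ minQ] := @QP l n (leq_trans (isT : 2 <= 3) (leq_trans (leq_addl _ _) ll0)).
  exact: leq_trans (minQ _ (K_free_le ll0 HK)) (ltnW Ha).
apply: leq_trans (leq_wexp2r b Qa) _.
rewrite -expnM mulnAC expnM leq_wexp2r //.
have u1 : u.-1 < u by rewrite prednK ?leqnn // (leq_ltn_trans (leq0n _) cu).
rewrite -(prednK (leq_ltn_trans (leq0n _) cu)) mulSn expnD leq_mul2l.
apply/orP; right; rewrite leqNgt; apply/negP => /ltnW /minu.
by rewrite leqNgt u1.
Qed.

Lemma K_free_few_edges r E h l n (G : sgraph 'I_n) :
  E ^ (h.+1 * h) < n -> l <= 2 * r + 4 -> K_free l G ->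
  (alpha G).+1 ^ (r.+1 * h) * n ^ r.+2 <= n ^ h ->
  E * #|edges G| < 2 * n ^ 2.
Proof.
move=> nE lr GK Hw; rewrite ltnNge; apply/negP => HE.
set w := (alpha G).+1 ^ r.+1.
have n0 : 0 < n by apply: leq_ltn_trans nE.
have large (U : {set 'I_n}) : w <= #|U| ->
    exists S : {set 'I_n}, [/\ S \subset U, clique G S & #|S| = r.+2].
  move=> /(clique_or_independent G)[//|[S [_ /independent_le_alpha]]].
  by rewrite leqNgt => /negP nS /nS.
have [||||U [nU hU]] := @dependent_random_choice 'I_n G E h r.+2 w; rewrite ?card_ord //.
  by rewrite /w -expnM.
have [|S [SU cS Sr]] := large U.
  rewrite leqNgt; apply/negP => Uw; move: nE; rewrite ltnNge => /negP; apply.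
  have nw : n <= E ^ h.+1 * w.
    by move: nU; rewrite card_ord => /leq_trans; apply; rewrite leq_mul2l Uw orbT.
  have nh0 : 0 < n ^ h by rewrite expn_gt0 n0.
  rewrite -(leq_pmul2l nh0).
  apply: (@leq_trans (n ^ h * n ^ r.+2)).
    by rewrite leq_mul2l -[n in n <= _]expn1 leq_pexp2l ?orbT.
  apply: leq_trans (leq_mul (leq_wexp2r h nw) (leqnn _)) _.
  by rewrite expnMn -!expnM -mulnA [leqRHS]mulnC leq_mul2l Hw orbT.
have [S' [S'N cS' S'r]] := large _ (hU S SU Sr).
have SS' : {in S & S', forall x y, adj G x y}.
  by move=> x y xS /(subsetP S'N); rewrite inE => /forall_inP; apply.
have dis : S :&: S' = set0.
  apply/setP => x; rewrite !inE; apply/negP => /andP[xS xS'].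
  by have := SS' x x xS xS'; rewrite adjxx.
have := K_freeP _ _ GK _ (clique_setU cS cS' SS').
by rewrite cardsU dis cards0 Sr S'r; lia.
Qed.

Lemma alpha_gt0 n (G : sgraph 'I_n) : 0 < n -> 0 < alpha G.
Proof.
move=> n0; rewrite -(cards1 (Ordinal n0)); apply: independent_le_alpha.
by apply/independentP => x y /set1P-> /set1P->; rewrite adjxx.
Qed.

(** * Edge density *)

From mathcomp Require Import all_order all_algebra.
From mathcomp Require Import all_classical all_reals all_analysis.
From mathcomp Require Import lra.
Import Order.TTheory GRing.Theory Num.Theory.
Local Open Scope ring_scope.

Lemma exists_nat_ge (R : realType) (x : R) : exists n : nat, x <= n%:R.
Proof. by exists (Num.truncn x).+1; rewrite ltW // Num.Theory.truncnS_gt. Qed.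

(* With s = r.+2, the exponent 1/s of Q is smaller than 1/(s-1) - c; d and h
   are chosen to absorb the losses in the bound on Q and in the dependent
   random choice. *)
Lemma alpha_exponent (R : realType) (r : nat) (c : R) : 0 < c ->
  c < (r.+2%:R * (r.+2%:R - 1))^-1 ->
  exists h n0 : nat, forall n l, (n0 <= n)%N -> (2 * r + 3 <= l)%N ->
  forall G : sgraph 'I_n, (alpha G)%:R < (Q l n)%:R * n%:R `^ c ->
  ((alpha G).+1 ^ (r.+1 * h) * n ^ r.+2 <= n ^ h)%N.
Proof.
move=> c0 cs; pose s : R := r.+2%:R.
have s2 : 2 <= s by rewrite /s ler_nat.
have ss0 : 0 < s * (s - 1) by rewrite mulr_gt0; lra.
have kap : 0 < 1 - c * (s * (s - 1)).
  by rewrite subr_gt0 -ltr_pdivlMr // div1r.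
have [d Hd] := exists_nat_ge ((2 * s) / (1 - c * (s * (s - 1)))).
have {Hd} Hd : 2 * s <= d%:R * (1 - c * (s * (s - 1))) by rewrite -ler_pdivrMr.
have d0 : (0 < d)%N.
  by rewrite lt0n; apply: contraTneq Hd => ->; rewrite mul0r -ltNge; lra.
have [n0 HQ] := Q_upper_bound r d0.
set b := ((r + 2) * d)%N in HQ.
have b0 : (0 < b)%N by rewrite /b muln_gt0 d0 addn2.
pose h := (r.+2 * b + 1)%N; pose j := (r.+1 * h)%N.
pose K := (2 ^ (b * j) * 2 ^ (b * (d + 2) * j))%N.
exists h, (maxn n0 K) => n l; rewrite geq_max => /andP[n0n Kn] lr G Ha.
have K0 : (0 < K)%N by rewrite muln_gt0 !expn_gt0.
have n1 : (0 < n)%N by apply: leq_trans Kn.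
have n1R : 1 <= n%:R :> R by rewrite ler1n.
set X := n%:R `^ c in Ha.
have X0 : 0 <= X by apply: powR_ge0.
have Ha2 : (alpha G).+1%:R <= 2 * (Q l n)%:R * X.
  have : 1 <= (alpha G)%:R :> R by rewrite ler1n alpha_gt0.
  by rewrite -natr1; lra.
rewrite -(leq_exp2r _ _ b0) -(ler_nat R).
have QR : (Q l n)%:R ^+ b <= (2 ^+ b * n%:R) ^+ (d + 2) :> R.
  by rewrite -!natrX -natrM -natrX ler_nat HQ.
have step1 : (((alpha G).+1 ^ (r.+1 * h) * n ^ r.+2) ^ b)%:R
   <= (2 ^+ b * (2 ^+ b * n%:R) ^+ (d + 2) * X ^+ b) ^+ j * n%:R ^+ (r.+2 * b) :> R.
  rewrite natrX natrM !natrX exprMn -!exprM ler_wpM2r ?exprn_ge0 ?ler0n //.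
  have P0 : 0 <= 2 * (Q l n)%:R * X by rewrite !mulr_ge0.
  have PB : (2 * (Q l n)%:R * X) ^+ b <=
      2 ^+ b * (2 ^+ b * n%:R) ^+ (d + 2) * X ^+ b.
    by rewrite (exprMn _ _ X) (exprMn _ 2) ler_wpM2r ?exprn_ge0 // ler_wpM2l ?exprn_ge0.
  rewrite mulnC exprM; apply: lerXn2r; rewrite ?nnegrE ?exprn_ge0 //.
    exact: le_trans (exprn_ge0 _ P0) PB.
  by apply: le_trans PB; apply: lerXn2r; rewrite ?nnegrE.
apply: le_trans step1 _.
have -> : (2 ^+ b * (2 ^+ b * n%:R) ^+ (d + 2) * X ^+ b) ^+ j * n%:R ^+ (r.+2 * b)
  = K%:R * (n%:R ^+ ((d + 2) * j + r.+2 * b) * X ^+ (b * j)) :> R.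
  rewrite /K natrM !natrX !exprMn -!exprM exprD -!mulrA.
  by rewrite [X ^+ _ * _]mulrC (mulnA b).
apply: (@le_trans _ _ (n%:R * (n%:R ^+ ((d + 2) * j + r.+2 * b) * X ^+ (b * j)))).
  by rewrite ler_wpM2r ?mulr_ge0 ?exprn_ge0 // ler_nat.
rewrite mulrA -exprS natrX natrX -exprM -[X in _ <= X]powR_mulrn // -powR_mulrn //.
rewrite -[X ^+ _]powR_mulrn // /X -powRrM -powRD; last first.
  by apply/implyP => _; rewrite pnatr_eq0 -lt0n.
apply: ler_powR => //.
have r1 : r.+1%:R = s - 1 :> R by rewrite /s -[r.+2%:R]natr1 addrK.
have bE : b%:R = s * d%:R :> R by rewrite /b natrM addn2.
have hE : h%:R = s * (s * d%:R) + 1 :> R by rewrite /h natrD natrM bE.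
have Hh : h%:R * (2 * s) <= h%:R * (d%:R * (1 - c * (s * (s - 1)))) :> R.
  by rewrite ler_wpM2l.
have jE : j%:R = (s - 1) * h%:R :> R by rewrite /j natrM r1.
rewrite -natr1 (natrD _ (_ * j)) (natrM _ (d + 2)) natrD (natrM _ r.+2).
rewrite (natrM _ b) (natrM _ h) bE jE -/s.
have := ler0n R h; move: hE Hh; move: (h%:R) (d%:R) => x y; lra.
Qed.

Theorem theorem3p1 (R : realType) (l : nat) (c : R) :
  (3 <= l)%N ->
  0 < c ->
  (* [uphalf l] is the ceiling of l / 2 *)
  c < ((uphalf l)%:R * ((uphalf l)%:R - 1))^-1 ->
  forall eps : R, 0 < eps ->
  exists n0 : nat, forall n : nat, (n0 <= n)%N ->
  forall G : sgraph 'I_n,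
    K_free l G ->
    (alpha G)%:R < (Q l n)%:R * n%:R `^ c ->
    #|edges G|%:R <= eps * n%:R ^+ 2.
Proof.
move=> l3 c0 cs eps eps0.
have [r lr] : exists r, uphalf l = r.+2.
  by exists (uphalf l).-2; case: l l3 {cs} => // -[|[|[|l]]].
have [rl lr2] : (2 * r + 3 <= l)%N /\ (l <= 2 * r + 4)%N.
  by split; move: lr (odd_double_half l); rewrite uphalf_half; case: odd => /=; lia.
rewrite lr in cs.
have [h [n0 Hh]] := alpha_exponent c0 cs.
have [E HE] := exists_nat_ge (2 / eps).
exists (maxn n0 (E ^ (h.+1 * h)).+1) => n; rewrite geq_max => /andP[n0n nE] G GK Ga.
have := K_free_few_edges nE lr2 GK (Hh n l n0n rl G Ga).
rewrite -(ltr_nat R) (natrM _ E) (natrM _ 2) natrX => He.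
have {HE} : 2 <= E%:R * eps by rewrite -ler_pdivrMr.
move=> HE; rewrite leNgt; apply/negP => He2.
have : (E%:R * eps) * n%:R ^+ 2 <= E%:R * #|edges G|%:R :> R.
  by rewrite -mulrA ler_wpM2l // ltW.
have : 2 * n%:R ^+ 2 <= (E%:R * eps) * n%:R ^+ 2 :> R by rewrite ler_wpM2r ?exprn_ge0.
lra.
Qed.
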